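(* Let $K,\beta\in\mathbb{N}$ with $\beta<K$ and let $\epsilon\in(0,1)$. If $\mathbb{U}$ is a vector space over a finite field with $|\mathbb{U}|$ finite and large enough, then there exists a tag function $J^*:\mathbb{U}^K\to\mathbb{U}$, that is, a function such that, whenever the adversarial data owners choose two different tuples of adversarial messages $X_{\mathcal{A},n_1}\neq X_{\mathcal{A},n_2}$ independently of the honest data $X_{\mathcal{H}}$ and send them to workers $n_1$ and $n_2$ respectively, $$\Pr\big(J^*(X_{\mathcal{H}},X_{\mathcal{A},n_1})=J^*(X_{\mathcal{H}},X_{\mathcal{A},n_2})\big)<\epsilon .$$
   Context: There are $K$ data owners, indexed by $[K]=\{1,\dots,K\}$. A nonempty subset $\mathcal{A}\subset[K]$ with $|\mathcal{A}|\le\beta$ consists of adversarial data owners, and $\mathcal{H}=[K]\setminus\mathcal{A}$ of honest ones. The set $\mathcal{A}$ is unknown to the workers, and the adversarial data owners may sit in any of the $K$ positions, so $J^*$ must not depend on $\mathcal{A}$. Each honest data owner $k\in\mathcal{H}$ has $X_k\in\mathbb{U}$, the $X_k$ being i.i.d. uniform on $\mathbb{U}$, and sends $X_k$ to every worker. $X_{\mathcal{H}}$ denotes the tuple $(X_k)_{k\in\mathcal{H}}$. $X_{\mathcal{A},n}=(X_{k,n})_{k\in\mathcal{A}}\in\mathbb{U}^{\mathcal{A}}$ denotes the tuple of messages received by worker $n$ from the adversarial data owners; the adversaries do not know $X_{\mathcal{H}}$, so these tuples are chosen independently of $X_{\mathcal{H}}$. The notation $J(X_{\mathcal{H}},X_{\mathcal{A},n})$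 stands for $J(X_{1,n},\dots,X_{K,n})$, where $X_{k,n}=X_k$ for $k\in\mathcal{H}$; that is, each message is placed in the coordinate of its data owner. The probability is over $X_{\mathcal{H}}$. Definition (tag function). A function $J:\mathbb{U}^K\to\mathbb{U}^l$ with $l<K$ is a tag function if, whenever two different tuples $X_{\mathcal{A},n_1}$ and $X_{\mathcal{A},n_2}$ are chosen by the adversaries independently of $X_{\mathcal{H}}$ and sent to workers $n_1,n_2$, one has $\Pr\big(J(X_{\mathcal{H}},X_{\mathcal{A},n_1})=J(X_{\mathcal{H}},X_{\mathcal{A},n_2})\big)<\epsilon$, where $\epsilon\in(0,1)$ is a (negligible) prescribed value. *)

(* Defs.v *)
From mathcomp Require Import all_boot all_order all_algebra.
From mathcomp Require Import reals.

Set Implicit Arguments.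
Unset Strict Implicit.
Unset Printing Implicit Defensive.

Import Order.TTheory GRing.Theory Num.Theory.

Local Open Scope ring_scope.

Section IidUniform.

Variables (R : realType) (U I : finType).

Definition unif (_ : U) : R := #|U|%:R^-1.

(* Probability of E when the coordinates (x_i)_(i : I) are i.i.d. uniform:
   the joint mass function is the product of the marginal ones. *)
Definition prob_iid (E : pred {ffun I -> U}) : R :=
  \sum_(x : {ffun I -> U} | E x) \prod_(i : I) unif (x i).

End IidUniform.

Section TagFunction.

Variables (K : nat) (U : finType) (A : {set 'I_K}).

Definition place (xH : {ffun {k : 'I_K | k \notin A} -> U})
    (xA : {ffun {k : 'I_K | k \in A} -> U}) : {ffun 'I_K -> U} :=
  [ffun k => match boolP (k \in A) with
             | AltTrue kA => xA (exist _ k kA)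
             | AltFalse kH => xH (exist _ k kH)
             end].

Lemma place_adv xH xA (k : {k : 'I_K | k \in A}) : place xH xA (val k) = xA k.
Proof.
rewrite ffunE; destruct (boolP _) as [kA|kH]; last by case/negP: (kH); apply: valP.
by congr (xA _); apply: val_inj.
Qed.

Lemma place_hon xH xA (k : {k : 'I_K | k \notin A}) :
  place xH xA (val k) = xH k.
Proof.
rewrite ffunE; destruct (boolP _) as [kA|kH]; first by case/negP: (valP k).
by congr (xH _); apply: val_inj.
Qed.

(* The collision probability is over the honest data only, so messages chosen
   independently of them are arbitrary fixed tuples a1 and a2. *)
Definition tag_function (R : realType) (eps : R) (l : nat)
    (J : {ffun 'I_K -> U} -> {ffun 'I_l -> U}) : Prop :=
  (l < K)%N /\
  forall a1 a2 : {ffun {k : 'I_K | k \in A} -> U}, a1 <> a2 ->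
    prob_iid R [pred xH : {ffun {k : 'I_K | k \notin A} -> U} |
                 J (place xH a1) == J (place xH a2)] < eps.

End TagFunction.

(* Main.v *)
Require Import Defs.
From mathcomp Require Import all_boot all_order all_algebra.
From mathcomp Require Import all_fingroup all_solvable all_field.
From mathcomp Require Import reals.

(** If [U] has [q] elements, [q] is a prime power, so [U] carries the structure
    of the field with [q] elements, whatever the given field of scalars is.
    Over it, take [J x = \sum_(i != j) x_i ^ (j + 2) * x_j].  Fix an honest
    owner [h] and freeze the data of the other honest owners.  As a polynomial
    in [x_h], [J] has degree at most [K + 1], and its coefficient at
    [x_h ^ (j + 2)] is [x_j] for every [j != h].  Two different adversarial
    tuples thus yield different polynomials, which agree at no more than
    [K + 1] points: a collision has probability at most [(K + 1) / q]. *)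

Import Order.TTheory GRing.Theory Num.Theory.
Local Open Scope ring_scope.

(** Generic in the ring, so that one formula serves both for field elements and for polynomials in
    the honest coordinate. *)
Definition tag_form {K : nat} {S : comNzRingType} (w : 'I_K -> S) : S :=
  \sum_i \sum_(j | j != i) w i ^+ j.+2 * w j.

Definition free_coord {K : nat} {L : comNzRingType} (h : 'I_K) (w : 'I_K -> L)
    (k : 'I_K) : {poly L} :=
  if k == h then 'X else (w k)%:P.

Section TagPolynomial.

Variables (K : nat) (L : comNzRingType) (h : 'I_K).
Implicit Types w : 'I_K -> L.

Lemma horner_tag_form w (u : L) :
  (tag_form (free_coord h w)).[u] =
  tag_form (fun k => if k == h then u else w k).
Proof.
have hv k : (free_coord h w k).[u] = if k == h then u else w k.
  by rewrite /free_coord; case: ifP; rewrite ?hornerX ?hornerC.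
rewrite horner_sum; apply: eq_bigr => i _; rewrite horner_sum.
by apply: eq_bigr => j _; rewrite hornerM horner_exp !hv.
Qed.

Lemma size_tag_form w : (size (tag_form (free_coord h w)) <= K.+2)%N.
Proof.
apply: leq_trans (size_sum _ _ _) _; apply/bigmax_leqP => i _.
apply: leq_trans (size_sum _ _ _) _; apply/bigmax_leqP => j nji.
rewrite /free_coord; case: (eqVneq i h) => [ih|_].
  rewrite ifN -?ih // mulrC mul_polyC.
  by rewrite (leq_trans (size_scale_leq _ _)) // size_polyXn !ltnS.
rewrite -polyC_exp mul_polyC (leq_trans (size_scale_leq _ _)) //.
by case: ifP => _; rewrite ?size_polyX // size_polyC; case: (_ == _).
Qed.

(** The summands with [i != h] have degree at most 1 in ['X]. The exponents [j.+2] start at 2 to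
    stay clear of them, and differ for different [j]. *)
Lemma coef_tag_form w (j0 : 'I_K) : j0 != h ->
  (tag_form (free_coord h w))`_j0.+2 = w j0.
Proof.
move=> nj0; rewrite coef_sum (bigD1 h) //= [X in _ + X]big1 => [|i nih].
  rewrite addr0 coef_sum (bigD1 j0) //= [X in _ + X]big1 => [|j /andP[njh njj0]].
    by rewrite /free_coord eqxx (negbTE nj0) addr0 coefMC coefXn eqxx mul1r.
  rewrite /free_coord eqxx (negbTE njh) coefMC coefXn !eqSS.
  by rewrite (inj_eq val_inj) eq_sym (negbTE njj0) mul0r.
rewrite coef_sum big1 // => j _.
rewrite /free_coord (negbTE nih) -polyC_exp coefCM.
by case: ifP => _; rewrite ?coefX ?coefC /= mulr0.
Qed.

End TagPolynomial.

Lemma card_inj_roots_lt (T : finType) (L : idomainType) (f : T -> L)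
    (p : {poly L}) :
  injective f -> p != 0 -> (#|[pred u | root p (f u)]| < size p)%N.
Proof.
move=> injf p0; rewrite cardE -(size_map f).
apply: max_poly_roots => //; last by rewrite map_inj_uniq ?enum_uniq.
by apply/allP => _ /mapP[u + ->]; rewrite mem_enum.
Qed.

(** Conditioning on all coordinates except [h]: each fiber has [#|U|] equally likely points, of
    which at most [d] lie in [E]. *)
Lemma prob_iid_le_fiber (R : realType) (U I : finType) (E : pred {ffun I -> U})
    (h : I) (d : nat) :
  (0 < #|U|)%N ->
  (forall x : {ffun I -> U},
     #|[pred u | E [ffun k => if k == h then u else x k]]| <= d)%N ->
  prob_iid R E <= d%:R / #|U|%:R.
Proof.
move=> U0 Ed.
pose upd (x : {ffun I -> U}) u := [ffun k => if k == h then u else x k].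
have qE : (#|E| * #|U| <= d * #|U| ^ #|I|)%N.
  rewrite -card_ffun mulnC [X in (_ <= X)%N]mulnC -[X in (_ <= X)%N]sum_nat_const.
  have -> : (#|U| * #|E| = \sum_(x : {ffun I -> U}) \sum_(u : U) E (upd x u))%N.
    (* Exchanging coordinate [h] with the spare value [u] turns [E (upd x u)] into [E x] with [u]
       free, hence the factor [#|U|]. *)
    pose swap (z : {ffun I -> U} * U) := (upd z.1 z.2, z.1 h).
    have swapK : involutive swap.
      case=> x u; rewrite /swap /= ffunE eqxx; congr (_, _).
      by apply/ffunP=> k; rewrite !ffunE; case: eqP => // ->.
    rewrite pair_big /= (reindex_inj (inv_inj swapK)) /=.
    rewrite (eq_bigr (fun z : {ffun I -> U} * U => E z.1 : nat)); last first.
      move=> [x u] _ /=; congr (nat_of_bool (E _)).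
      by apply/ffunP=> k; rewrite !ffunE; case: eqP => // ->.
    rewrite -(pair_big xpredT xpredT (fun x _ => E x : nat)) /= exchange_big /=.
    rewrite sum_nat_const; congr (_ * _)%N.
    rewrite -sum1_card big_mkcond; apply: eq_bigr => x _.
    by rewrite unfold_in; case: (E x).
  apply: leq_sum => x _; apply: leq_trans (Ed x).
  rewrite -sum1_card [leqRHS]big_mkcond; apply: leq_sum => u _.
  by rewrite unfold_in /=; case: (E _).
have q0 : 0 < #|U|%:R :> R by rewrite ltr0n.
rewrite /prob_iid (eq_bigr (fun=> (#|U|%:R ^+ #|I|)^-1)); last first.
  by move=> x _; rewrite /unif prodr_const exprVn.
rewrite sumr_const -[X in X <= _]mulr_natl ler_pdivrMr ?exprn_gt0 //.
by rewrite mulrAC ler_pdivlMr // -natrX -!natrM ler_nat.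
Qed.

(** The characteristic [p] of [F] kills [U]. By Cauchy, a prime [r] dividing [#|U|] is the order of
    some element, so [r] divides [p]. *)
Lemma card_finLmod_prime_power (F : finFieldType) (U : finLmodType F) :
  exists2 p : nat, prime p & exists n, #|U| = (p ^ n)%N.
Proof.
have [p pp pF] := finPcharP F; exists p => //.
suff /p_natP[n cU] : p.-nat #|U| by exists n.
apply/pnatP => [|r pr]; first by apply/card_gt0P; exists 0.
rewrite -cardsT => rdv.
have [x _ ox] := Cauchy (G := [group of [set: U]]) pr rdv.
have: (x ^+ p)%g = 1%g.
  rewrite FinRing.zmodXgE FinRing.zmod1gE -[x]scale1r scalerMnl.
  by rewrite (pcharf0 pF) scale0r.
by move/eqP; rewrite -order_dvdn ox dvdn_prime2.
Qed.

(** A bare bijection of sets suffices: uniform probabilities of collisions only count points. *)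
Lemma finLmod_bij_finField {F : finFieldType} {U : finLmodType F} :
  (1 < #|U|)%N ->
  exists (L : finFieldType) (f : U -> L), bijective f.
Proof.
have [p pp [[|n] cU]] := card_finLmod_prime_power F U; first by rewrite cU.
have [L _ cL] := PrimePowerField pp (ltn0Sn n).
have cUL : #|U| = #|L| by rewrite cU cL.
move=> _; exists L, (fun u => enum_val (cast_ord cUL (enum_rank u))).
exists (fun y => enum_val (cast_ord (esym cUL) (enum_rank y))) => z.
  by rewrite enum_valK cast_ordK enum_rankK.
by rewrite enum_valK cast_ordKV enum_rankK.
Qed.

Theorem theorem2 (R : realType) (K beta : nat) (eps : R)
    (hbeta : (beta < K)%N) (heps0 : 0 < eps) (heps1 : eps < 1) :
  exists N : nat, forall (F : finFieldType) (U : finLmodType F),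
    (N <= #|U|)%N ->
    exists Jstar : {ffun 'I_K -> U} -> U,
      forall A : {set 'I_K}, A != set0 -> (#|A| <= beta)%N ->
        tag_function A eps (fun x => [ffun _ : 'I_1 => Jstar x]).
Proof.
(* The bound 2 excludes the zero space, which has no field structure; the other one gives
   [K.+1 / #|U| < eps]. *)
exists (maxn 2 (Num.bound (K.+1%:R / eps))) => F U.
rewrite geq_max => /andP[U1 Ub].
have [L [f [g fK gK]]] := finLmod_bij_finField U1.
exists (fun x => g (tag_form (fun k => f (x k)))) => A A0 Ab; split.
  (* Here [l = 1], and [1 <= #|A| <= beta < K]. *)
  by apply: leq_ltn_trans hbeta; apply: leq_trans Ab; rewrite card_gt0.
move=> a1 a2 a12.
have [h hA] : exists h, h \notin A.
  apply/existsP; rewrite -negb_forall; apply: contraL hbeta => /forallP AT.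
  rewrite -leqNgt; apply: leq_trans Ab.
  by rewrite -[X in (X <= _)%N]card_ord; apply/subset_leq_card/subsetP => k _.
apply: (@le_lt_trans _ _ (K.+1%:R / #|U|%:R)); last first.
  rewrite ltr_pdivrMr ?ltr0n 1?ltnW // mulrC -ltr_pdivrMr //.
  apply: lt_le_trans (archi_boundP _) _; last by rewrite ler_nat.
  by rewrite divr_ge0 // ltW.
apply: (@prob_iid_le_fiber _ _ _ _ (exist _ h hA)) => [|x]; first exact: ltnW.
pose w a k := f (place x a k).
pose P a : {poly L} := tag_form (free_coord h (w a)).
have [j aj] : exists j, a1 j != a2 j.
  by apply/existsP; rewrite -negb_forall; apply/negP => /forallP aE;
    apply: a12; apply/ffunP => j; apply/eqP/aE.
have njh : val j != h by apply: contraNneq hA => <-; apply: valP.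
have P12 : P a1 - P a2 != 0.
  (* The coefficients at [(val j).+2] are [f (a1 j)] and [f (a2 j)], distinct because [f] is
     injective. *)
  apply: contraNneq aj => P0.
  apply/eqP/(can_inj fK); apply/eqP; rewrite -subr_eq0.
  have := congr1 (fun p : {poly L} => p`_(val j).+2) P0.
  by rewrite coefB !coef_tag_form // coef0 /w !place_adv => /eqP.
have szP : (size (P a1 - P a2)%R <= K.+2)%N.
  by rewrite (leq_trans (size_polyD _ _)) // size_polyN geq_max !size_tag_form.
rewrite -ltnS; apply: leq_trans szP.
apply: leq_ltn_trans (card_inj_roots_lt U L f _ (can_inj fK) P12).
apply: subset_leq_card; apply/subsetP => u; rewrite !inE => /eqP/ffunP/(_ ord0).
rewrite !ffunE => /(can_inj gK) eqJ.
rewrite rootE hornerD hornerN subr_eq0 !horner_tag_form; apply/eqP.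
(* Resampling the honest coordinate [h] before placing the messages amounts to evaluating the
   polynomial at [f u]. *)
have wE a k : f (place [ffun k => if k == exist _ h hA then u else x k] a k)
    = if k == h then f u else w a k.
  have [kA|kH] := boolP (k \in A).
    rewrite /w ifN; last by apply: contraNneq (hA) => <-.
    by rewrite !(place_adv _ _ (exist _ k kA)).
  rewrite /w !(place_hon _ _ (exist _ k kH)) ffunE -val_eqE /=.
  by case: eqP.
have tagE (v v' : 'I_K -> L) : v =1 v' -> tag_form v = tag_form v'.
  by move=> vv; apply: eq_bigr => i _; apply: eq_bigr => k _; rewrite !vv.
by rewrite -!(tagE _ _ (wE _)).
Qed.
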